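(* Fix the initial pooled class counts $R_m^{(0)}=\sum_k n_{k,m}$ ($m\in\mathcal M$), the batch size $B$, and every random variable used to construct the integer targets (the class permutation and rounding offset of every step). Then any two feasible realization policies generate the same complete target stream $\hat h^{(0)},\hat h^{(1)},\dots$ for the epoch.
   Context: There are clients $\mathcal K=\{1,\dots,K\}$ and classes $\mathcal M=\{1,\dots,M\}$. Client $k$ initially holds $n_{k,m}\in\mathbb Z_{\ge0}$ examples of class $m$. Let $r^{(t)}_{k,m}$ be the number of unused class-$m$ examples at client $k$ before step $t$, with $r^{(0)}_{k,m}=n_{k,m}$. Put $R_m^{(t)}=\sum_k r_{k,m}^{(t)}$, $R^{(t)}=\sum_m R_m^{(t)}$, $B_t=\min\{B,R^{(t)}\}$ with $B\ge1$ an integer, and $\beta_m^{(t)}=R_m^{(t)}/R^{(t)}$. Steps continue while $R^{(t)}>0$. Target at step $t$: with $x_m=B_t\beta^{(t)}_m$, the integer target $\hat h^{(t)}$ is obtained either by deterministic rounding (start from $\lfloor x_m\rfloor$ and add one unit to the $B_t-\sum_m\lfloor x_m\rfloor$ classes with largest fractional parts, with a fixed tie rule) or by randomized systematic rounding: permute the classes by a permutation $\pi_t$, draw an offset $U_t\in(0,1)$, set, in the permuted order, $\hat h_j=\lfloor\sum_{i\le j}x_i+U_t\rfloor-\lfloor\sum_{i<j}x_i+U_t\rfloor$, and map back to the original order. One construction is used throughout. A feasible realization policy chooses, at each step $t$, integers $q^{(t)}_{k,m}$ with $0\le q^{(t)}_{k,m}\le r^{(t)}_{k,m}$ and $\sum_k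 q^{(t)}_{k,m}=\hat h^{(t)}_m$ for every $m$; the state is then updated by $r^{(t+1)}_{k,m}=r^{(t)}_{k,m}-q^{(t)}_{k,m}$. The target stream is the sequence of targets until no examples remain. *)

(* Defs.v *)
From HB Require Import structures.
From mathcomp Require Import all_boot all_order all_algebra all_fingroup.
From mathcomp Require Import reals.

Set Implicit Arguments.
Unset Strict Implicit.
Unset Printing Implicit Defensive.

Import Order.TTheory GRing.Theory Num.Theory.
Local Open Scope ring_scope.

Section Rounding.
Variables (R : realType) (M : nat).

Definition frac (y : R) : R := y - (Num.floor y)%:~R.

(* A fixed tie rule is an arbitrary function of the fractional-part problem:
   from the vector x and the number d of extra units it returns d classes with
   largest fractional parts, deciding in its own way between equal ones. *)
Record tie_rule := TieRule {
  top_fracs :> {ffun 'I_M -> R} -> nat -> {set 'I_M};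
  top_fracs_card : forall x d, (d <= M)%N -> #|top_fracs x d| = d;
  top_fracs_largest : forall x d i j, (d <= M)%N ->
    i \in top_fracs x d -> j \notin top_fracs x d -> frac (x j) <= frac (x i)
}.

(* The second constructor carries the class permutation and the offset of every
   step: they are realized values, fixed in advance for the whole epoch. *)
Inductive rounding :=
| Deterministic of tie_rule
| Systematic (pi : nat -> {perm 'I_M}) (U : nat -> R)
    of (forall t, 0 < U t < 1).

(* absz only casts to nat: b - \sum_m floor (x m) >= 0 whenever
   the x m sum to b. *)
Definition det_round (tie : tie_rule) (b : nat) (x : {ffun 'I_M -> R}) :
    {ffun 'I_M -> int} :=
  let d := absz (b%:Z - \sum_m Num.floor (x m))%R in
  [ffun m => Num.floor (x m) + (m \in tie x d : nat)%:Z].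

(* Position j of the permuted order holds the class s j. *)
Definition sys_round (s : {perm 'I_M}) (u : R) (x : {ffun 'I_M -> R}) :
    {ffun 'I_M -> int} :=
  let h (j : 'I_M) :=
    Num.floor (\sum_(i < M | (i <= j)%N) x (s i) + u)
    - Num.floor (\sum_(i < M | (i < j)%N) x (s i) + u) in
  [ffun m => h ((s^-1)%g m)].

Definition round_at (c : rounding) (t b : nat) (x : {ffun 'I_M -> R}) :
    {ffun 'I_M -> int} :=
  match c with
  | Deterministic tie => det_round tie b x
  | Systematic pi U _ => sys_round (pi t) (U t) x
  end.

End Rounding.

Section Epoch.
Variables (R : realType) (K M : nat).

Definition allocation := 'I_K -> 'I_M -> nat.

Definition pooled (r : allocation) (m : 'I_M) : nat := (\sum_(k < K) r k m)%N.

Definition total (r : allocation) : nat := (\sum_(m < M) pooled r m)%N.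

Definition batch (B : nat) (r : allocation) : nat := minn B (total r).

Definition share (r : allocation) (m : 'I_M) : R :=
  (pooled r m)%:R / (total r)%:R.

Definition target (c : rounding R M) (B t : nat) (r : allocation) :
    {ffun 'I_M -> int} :=
  round_at c t (batch B r) [ffun m => (batch B r)%:R * share r m].

(* A policy enters through the choices q t it makes along its run; these may
   come from any adaptive or randomized rule.  Once total (remaining n q t) = 0
   the state stays 0 whatever q is, because subtraction is truncated. *)
Fixpoint remaining (n : allocation) (q : nat -> allocation) (t : nat) :
    allocation :=
  if t is t'.+1 then fun k m => (remaining n q t' k m - q t' k m)%N else n.

Definition feasible (c : rounding R M) (B : nat) (n : allocation)
    (q : nat -> allocation) : Prop :=
  forall t, let r := remaining n q t in (0 < total r)%N ->
    (forall k m, (q t k m <= r k m)%N) /\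
    (forall m, (\sum_(k < K) q t k m)%N%:Z = target c B t r m).

(* None from the first step at which no example is left, so that equal streams
   have equal targets and equal length. *)
Definition target_stream (c : rounding R M) (B : nat) (n : allocation)
    (q : nat -> allocation) (t : nat) : option {ffun 'I_M -> int} :=
  let r := remaining n q t in
  if (0 < total r)%N then Some (target c B t r) else None.

End Epoch.

(* Main.v *)
(* The target at a step depends on the allocation only through its pooled class
   counts, and a feasible step lowers these counts by exactly the target, so by
   induction the pooled counts of both runs agree at every step. *)
Require Import Defs.
From HB Require Import structures.
From mathcomp Require Import all_boot all_order all_algebra all_fingroup.
From mathcomp Require Import reals.

Set Implicit Arguments.
Unset Strict Implicit.
Unset Printing Implicit Defensive.

Import Order.TTheory GRing.Theory Num.Theory.
Local Open Scope ring_scope.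

Lemma eq_total (K M : nat) (r1 r2 : allocation K M) :
  pooled r1 =1 pooled r2 -> Defs.total r1 = Defs.total r2.
Proof. by move=> eqr; apply: eq_bigr => m _; exact: eqr. Qed.

(** The tie rule, permutation and offset come from [c] and [t] alone, so the allocation enters only
    through the batch size and the shares. *)
Lemma eq_target (R : realType) (K M : nat) (c : rounding R M) (B t : nat)
    (r1 r2 : allocation K M) :
  pooled r1 =1 pooled r2 -> target c B t r1 = target c B t r2.
Proof.
move=> eqr; rewrite /target /batch (eq_total eqr); congr round_at.
by apply/ffunP => m; rewrite !ffunE /share eqr (eq_total eqr).
Qed.

(** Truncated subtraction commutes with the sum over clients because the bound at each client keeps
    every difference exact. *)
Lemma pooled_sub (K M : nat) (r q : allocation K M) (m : 'I_M) :
  (forall k, (q k m <= r k m)%N) ->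
  pooled (fun k m => (r k m - q k m)%N) m = (pooled r m - pooled q m)%N.
Proof. by move=> leqr; rewrite /pooled sumnB. Qed.

Lemma total_eq0_pooled (K M : nat) (r : allocation K M) (m : 'I_M) :
  Defs.total r = 0%N -> pooled r m = 0%N.
Proof. by move/eqP; rewrite sum_nat_eq0 => /forallP/(_ m)/eqP. Qed.

(** Serves the exhausted state, where feasibility says nothing about [q]. *)
Lemma pooled_sub_le (K M : nat) (r q : allocation K M) (m : 'I_M) :
  (pooled (fun k m => (r k m - q k m)%N) m <= pooled r m)%N.
Proof. by apply: leq_sum => k _; exact: leq_subr. Qed.

Lemma eq_pooled_remaining (R : realType) (K M B : nat) (c : rounding R M)
    (n1 n2 : allocation K M) (q1 q2 : nat -> allocation K M) :
  pooled n1 =1 pooled n2 -> feasible c B n1 q1 -> feasible c B n2 q2 ->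
  forall t, pooled (remaining n1 q1 t) =1 pooled (remaining n2 q2 t).
Proof.
move=> eqn feas1 feas2; elim=> [//|t IHt] m /=.
have [pos1|] := ltnP 0 (Defs.total (remaining n1 q1 t)).
  have pos2 : (0 < Defs.total (remaining n2 q2 t))%N by rewrite -(eq_total IHt).
  have [le1 sum1] := feas1 t pos1; have [le2 sum2] := feas2 t pos2.
  rewrite !pooled_sub // IHt; congr (_ - _)%N.
  (* Both pooled choices equal the same integer target; injectivity of the embedding of [nat] into
     [int] brings the equality back to [nat]. *)
  have := sum1 m; rewrite (eq_target c B t IHt) -(sum2 m).
  by case.
(* An exhausted run stays exhausted because subtraction is truncated. *)
rewrite leqn0 => /eqP tot1; have tot2 := tot1; rewrite (eq_total IHt) in tot2.
have := pooled_sub_le (remaining n1 q1 t) (q1 t) m.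
have := pooled_sub_le (remaining n2 q2 t) (q2 t) m.
by rewrite (total_eq0_pooled m tot1) (total_eq0_pooled m tot2) !leqn0 => /eqP-> /eqP->.
Qed.

Theorem proposition2 (R : realType) (K M B : nat) (hB : (1 <= B)%N)
    (c : rounding R M) (n1 n2 : allocation K M) (q1 q2 : nat -> allocation K M)
    (hpool : forall m : 'I_M, pooled n1 m = pooled n2 m)
    (hq1 : feasible c B n1 q1) (hq2 : feasible c B n2 q2) :
  forall t : nat, target_stream c B n1 q1 t = target_stream c B n2 q2 t.
Proof.
move=> t; have eqr := eq_pooled_remaining hpool hq1 hq2 t.
(* Equal totals make both streams end at the same step. *)
by rewrite /target_stream (eq_total eqr) (eq_target c B t eqr).
Qed.
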